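(* Let $(\gamma_n)_{n}$ be a sequence of reals bounded between two positive constants, and let $a,b,c\ge 0$ and $0<f<1$ be constants with $af<1$. For each $n$ consider a homogeneous rumor spreading process on $n$ nodes with success probabilities $p_k$ and covariance numbers $c_k$, and suppose that for all sufficiently large $n$ and all integers $k$ with $1\le k<fn$, (i) $p_k \ge \gamma_n \frac{k}{n}\left(1-a\frac{k}{n}-\frac{b}{\ln n}\right)$, and (ii) $c_k\le c\,\frac{k}{n^2}$. Then $\mathbb{E}[T(1,fn)] \le \log_{1+\gamma_n} n + O(1)$, and there exist constants $A',\alpha'>0$ such that for all sufficiently large $n$ and all $r\in\mathbb{N}$, $\Pr[T(1,fn) > \log_{1+\gamma_n} n + r]\le A' e^{-\alpha' r}$.
   Context: Homogeneous rumor spreading process on $n$ nodes: time proceeds in rounds $1,2,\dots$. Each node is informed or uninformed; informed nodes stay informed; the process starts with exactly one informed node. The process is memoryless: the joint law of the set of nodes newly informed in a round depends only on the set of nodes informed at the beginning of that round. Moreover, in any round starting with exactly $k$ informed nodes, each uninformed node becomes informed in that round with probability exactly $p_k$, a number depending only on $k$ (and on the process and $n$). The covariance number $c_k$ ($1\le k\le n-1$) is the smallest number such that, whenever a round starts with $k$ informed nodes, for any two distinct uninformed nodes $x_1,x_2$ the indicator random variables $X_1,X_2$ of the events that these nodes become informed in this round satisfy $\mathrm{Cov}[X_1,X_2]\le c_k$ (upper bounds on $c_{n-1}$ are vacuous). $T(k,m)$ (with $k\le m\le n$, $m$ real) denotes the number of rounds it takes, starting from a moment at which exactly $k$ nodes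 are informed, until at least $m$ nodes are informed. One has one process for each $n$; $O(1)$ denotes a quantity bounded in absolute value by a constant independent of $n$, for all sufficiently large $n$. *)

(* Defs.v *)
From HB Require Import structures.
From mathcomp Require Import all_boot all_order all_algebra.
From mathcomp Require Import all_classical all_reals all_analysis.

Set Implicit Arguments.
Unset Strict Implicit.
Unset Printing Implicit Defensive.

Import Order.TTheory GRing.Theory Num.Theory.
Import numFieldNormedType.Exports.

Local Open Scope classical_set_scope.
Local Open Scope ring_scope.

(* One round on the node set 'I_n: [K S A] is the probability that A is the set
   of informed nodes at the end of a round that starts with informed set S. As
   informed nodes stay informed, this carries the same information as the joint
   law of the set [A :\: S] of newly informed nodes. *)
Definition round_kernel (R : realType) (n : nat)
    (K : {set 'I_n} -> {set 'I_n} -> R) : Prop :=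
  forall S : {set 'I_n},
    [/\ forall A : {set 'I_n}, 0 <= K S A,
        \sum_(A : {set 'I_n}) K S A = 1 &
        forall A : {set 'I_n}, ~~ (S \subset A) -> K S A = 0].

Definition round_mean (R : realType) (n : nat)
    (K : {set 'I_n} -> {set 'I_n} -> R) (S : {set 'I_n})
    (F : {set 'I_n} -> R) : R :=
  \sum_(A : {set 'I_n}) K S A * F A.

(* For x outside S this is the indicator of "x becomes informed in the round". *)
Definition informed_ind (R : realType) (n : nat) (x : 'I_n)
    (A : {set 'I_n}) : R := (x \in A)%:R.

Definition round_cov (R : realType) (n : nat)
    (K : {set 'I_n} -> {set 'I_n} -> R) (S : {set 'I_n}) (x y : 'I_n) : R :=
  round_mean K S (fun A =>
    (informed_ind R x A - round_mean K S (informed_ind R x)) *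
    (informed_ind R y A - round_mean K S (informed_ind R y))).

Definition homogeneous (R : realType) (n : nat)
    (K : {set 'I_n} -> {set 'I_n} -> R) (p : nat -> R) : Prop :=
  forall (S : {set 'I_n}) (x : 'I_n), (0 < #|S|)%N -> x \notin S ->
    round_mean K S (informed_ind R x) = p #|S|.

(* The least upper bound of finitely many reals; it is -oo when there is no pair
   of distinct uninformed nodes (k = n - 1), so that upper bounds are vacuous. *)
Definition covariance_number (R : realType) (n : nat)
    (K : {set 'I_n} -> {set 'I_n} -> R) (k : nat) : \bar R :=
  ereal_sup [set z : \bar R | exists (S : {set 'I_n}) (x y : 'I_n),
    [/\ #|S| = k, x \notin S, y \notin S, x != y &
        z = (round_cov K S x y)%:E]].

(* [X t] is the set of informed nodes after t rounds. The last clause says that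
   X is a Markov chain with transition kernel K. The initially informed node is
   arbitrary, possibly random. *)
Definition rumor_process (R : realType) (d : measure_display)
    (Om : measurableType d) (P : probability Om R) (n : nat)
    (K : {set 'I_n} -> {set 'I_n} -> R) (X : nat -> Om -> {set 'I_n}) : Prop :=
  [/\ forall (t : nat) (A : {set 'I_n}), measurable [set w | X t w = A],
      forall w : Om, #|X 0%N w| = 1%N &
      forall (t : nat) (h : nat -> {set 'I_n}),
        P [set w | forall s : nat, (s <= t.+1)%N -> X s w = h s] =
        (P [set w | forall s : nat, (s <= t)%N -> X s w = h s]
          * (K (h t) (h t.+1))%:E)%E].

(* The number T(1, m) of rounds until at least m nodes are informed; it is +oo
   if this never happens. *)
Definition spreading_time (R : realType) (Om : Type) (n : nat)
    (X : nat -> Om -> {set 'I_n}) (m : R) (w : Om) : \bar R :=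
  ereal_inf [set z : \bar R | exists t : nat,
    m <= #|X t w|%:R /\ z = (t%:R : R)%:E].

Definition log_base (R : realType) (b x : R) : R := ln x / ln b.

(* Main.v *)
(* The potential V(k) = (n/k)^s (1 + (1/k - k/n)/2), for a small constant s > 0,
   is an approximate supermartingale. If K' is the size after a round started
   with k < f n informed nodes, and g = gamma_n, then
   (1+g)^s E[V(K')] <= (1 + O(1/ln n)) V(k). This follows from two estimates of
   the ratio rho = k/K' (both obtained from the mean and variance of K'):
   - E[(1+g) rho] <= 1 + O(1/k + k/n + 1/ln n), whose error enters V multiplied
     by s through Bernoulli's inequality y^s <= 1 + s (y - 1);
   - E[rho] <= 1 - eta, which makes the correction terms 1/k and k/n of V
     improve by an amount independent of s, hence dominate the error if s is small.
   Since V >= 1/2 below f n and V(1) <= 2 n^s, the probability that fewer than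
   f n nodes are informed during rounds 0..t is O(n^s (1+g)^(-s t)), up to a factor
   (1 + O(1/ln n))^t. With t = log_{1+g} n + r this is exponentially small in r,
   and summing over t bounds the mean. *)

Require Import Defs.
From HB Require Import structures.
From mathcomp Require Import all_boot all_order all_algebra.
From mathcomp Require Import all_classical all_reals all_analysis.
From mathcomp Require Import measurable_realfun ring lra.

Set Implicit Arguments.
Unset Strict Implicit.
Unset Printing Implicit Defensive.

Import Order.TTheory GRing.Theory Num.Theory.
Import numFieldNormedType.Exports.

Local Open Scope classical_set_scope.
Local Open Scope ring_scope.

(** * Mean and variance of the number of informed nodes after one round *)

Section RoundMean.
Variables (R : realType) (n : nat) (K : {set 'I_n} -> {set 'I_n} -> R).
Implicit Types (S A : {set 'I_n}) (F G : {set 'I_n} -> R).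

Lemma round_meanD S F G :
  round_mean K S (fun A => F A + G A) = round_mean K S F + round_mean K S G.
Proof. by rewrite /round_mean -big_split; apply: eq_bigr => A _; rewrite mulrDr. Qed.

Lemma round_meanZ S (u : R) F :
  round_mean K S (fun A => u * F A) = u * round_mean K S F.
Proof. by rewrite /round_mean big_distrr; apply: eq_bigr => A _; rewrite mulrCA. Qed.

Lemma round_mean_sum (I : finType) S (F : I -> {set 'I_n} -> R) :
  round_mean K S (fun A => \sum_i F i A) = \sum_i round_mean K S (F i).
Proof.
rewrite /round_mean exchange_big; apply: eq_bigr => A _.
by rewrite big_distrr.
Qed.

Hypothesis kernelK : round_kernel K.

Lemma round_mean_cst S (u : R) : round_mean K S (fun=> u) = u.
Proof. by have [_ K1 _] := kernelK S; rewrite /round_mean -big_distrl /= K1 mul1r. Qed.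

Lemma le_round_mean S F G : (forall A, S \subset A -> F A <= G A) ->
  round_mean K S F <= round_mean K S G.
Proof.
have [K0 _ Ksub] := kernelK S => FG; apply: ler_sum => A _.
have [SA|SA] := boolP (S \subset A); first by rewrite ler_wpM2l ?FG.
by rewrite Ksub // !mul0r.
Qed.

Lemma eq_round_mean S F G : (forall A, S \subset A -> F A = G A) ->
  round_mean K S F = round_mean K S G.
Proof.
by move=> FG; apply/eqP; rewrite eq_le !le_round_mean// => A /FG ->.
Qed.

Lemma cardE_informed A : #|A|%:R = \sum_(x < n) informed_ind R x A.
Proof.
rewrite -sum1_card natr_sum big_mkcond; apply: eq_bigr => x _.
by rewrite /informed_ind; case: (x \in A).
Qed.

Lemma round_mean_informed S (x : 'I_n) : x \in S ->
  round_mean K S (informed_ind R x) = 1.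
Proof.
move=> xS; rewrite -[RHS](round_mean_cst S); apply: eq_round_mean => A /fintype.subsetP/(_ x xS) xA.
by rewrite /informed_ind xA.
Qed.

Lemma round_covC S x y : round_cov K S x y = round_cov K S y x.
Proof. by apply: eq_bigr => A _; congr (_ * _); rewrite mulrC. Qed.

Lemma round_cov_informed S x y : x \in S -> round_cov K S x y = 0.
Proof.
move=> xS; rewrite -[RHS](round_mean_cst S); apply: eq_round_mean => A /fintype.subsetP/(_ x xS) xA.
by rewrite round_mean_informed// /informed_ind xA subrr mul0r.
Qed.

Lemma round_cov_diag S x :
  round_cov K S x x <= round_mean K S (informed_ind R x).
Proof.
set e := round_mean _ _ _.
have -> : round_cov K S x x =
  round_mean K S (fun A => (1 - 2 * e) * informed_ind R x A + e ^+ 2).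
  apply: eq_round_mean => A _; rewrite -/e /informed_ind.
  by case: (x \in A) => /=; ring.
rewrite round_meanD round_meanZ round_mean_cst -/e.
have := sqr_ge0 e; lra.
Qed.

Variable p : nat -> R.
Hypothesis homK : homogeneous K p.

Lemma card_notin S : (\sum_(x < n) (x \notin S)%:R : R) = n%:R - #|S|%:R.
Proof.
have -> : n%:R = #|S|%:R + #|~: S|%:R :> R by rewrite -natrD cardsC card_ord.
rewrite addrAC subrr add0r -sum1_card natr_sum.
rewrite [RHS]big_mkcond; apply: eq_bigr => x _.
by rewrite inE; case: (x \in S).
Qed.

Lemma round_mean_card S : (0 < #|S|)%N ->
  round_mean K S (fun A => #|A|%:R) = #|S|%:R + (n%:R - #|S|%:R) * p #|S|.
Proof.
move=> S0.
rewrite (eq_round_mean (G := fun A => \sum_(x < n) informed_ind R x A)); last first.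
  by move=> A _; rewrite cardE_informed.
rewrite round_mean_sum -card_notin cardE_informed big_distrl -big_split /=.
apply: eq_bigr => x _; have [xS|xS] := boolP (x \in S).
  by rewrite round_mean_informed// /informed_ind xS mul0r addr0.
by rewrite homK// /informed_ind (negbTE xS) add0r mul1r.
Qed.

(** The variance is the double sum of the covariances. Rows and columns of informed nodes vanish;
    each of the other [n - #|S|] rows has a diagonal entry of at most [p #|S|] and fewer than [n]
    further entries of at most [v]. *)
Lemma round_var_card S (v : R) : (0 < #|S|)%N -> 0 <= v ->
  (covariance_number K #|S| <= v%:E)%E ->
  round_mean K S (fun A => (#|A|%:R - round_mean K S (fun B => #|B|%:R)) ^+ 2)
  <= (n%:R - #|S|%:R) * (p #|S| + n%:R * v).
Proof.
move=> S0 v0 cov_v.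
set e := fun x => round_mean K S (informed_ind R x).
have -> : round_mean K S (fun B => #|B|%:R) = \sum_(x < n) e x.
  rewrite -round_mean_sum; apply: eq_round_mean => A _; exact: cardE_informed.
rewrite (eq_round_mean (G := fun A => \sum_(x < n) \sum_(y < n)
   (informed_ind R x A - e x) * (informed_ind R y A - e y))); last first.
  move=> A _; rewrite cardE_informed -sumrB expr2 big_distrl /=.
  by apply: eq_bigr => x _; rewrite big_distrr.
rewrite round_mean_sum -card_notin big_distrl /=; apply: ler_sum => x _.
rewrite round_mean_sum.
have [xS|xS] := boolP (x \in S).
  by rewrite mul0r big1// => y _; exact: round_cov_informed.
rewrite mul1r (bigD1 x)//=; apply: lerD.
  by rewrite -(homK S0 xS); exact: round_cov_diag.
have -> : n%:R * v = \sum_(y < n) v by rewrite sumr_const card_ord mulr_natl.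
rewrite [leLHS]big_mkcond; apply: ler_sum => y _.
case: ifPn => // yx; have [yS|yS] := boolP (y \in S).
  by rewrite -[leLHS]/(round_cov K S x y) round_covC round_cov_informed.
rewrite -lee_fin; apply: le_trans cov_v; apply: ereal_sup_ubound.
by exists S, x, y; split => //; rewrite eq_sym.
Qed.

End RoundMean.

(** Concavity of [ln]: the right-hand side [z] is the mean of [y] and [1] with weights [s] and
    [1 - s], so [s * ln y <= ln z]. *)
Lemma powR_bernoulli (R : realType) (y s : R) : 0 < y -> 0 <= s <= 1 ->
  y `^ s <= 1 + s * (y - 1).
Proof.
move=> y0 /andP[s0 s1]; set z := 1 + s * (y - 1).
have z0 : 0 < z.
  have [s00|s0'] := eqVneq s 0; first by rewrite /z s00; lra.
  have : 0 < s * y by rewrite mulr_gt0// lt0r s0'.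
  rewrite /z; lra.
have ys0 := powR_gt0 s y0.
rewrite -ler_ln ?posrE// ln_powR.
(* weighted sum of [ln t <= t - 1] at [t = y / z] and [t = 1 / z] *)
have h1 := le_ln1Dx (x := y / z - 1).
have h2 := le_ln1Dx (x := z^-1 - 1).
have yz0 : 0 < y / z by rewrite divr_gt0.
have zi0 : 0 < z^-1 by rewrite invr_gt0.
rewrite (_ : 1 + (_ - 1) = y / z) ?ln_div ?posrE// in h1; last by ring.
rewrite (_ : 1 + (_ - 1) = z^-1) ?lnV ?posrE// in h2; last by ring.
have {}h1 : s * (ln y - ln z) <= s * (y / z - 1) by rewrite ler_wpM2l// h1//; lra.
have {}h2 : (1 - s) * (- ln z) <= (1 - s) * (z^-1 - 1).
  by rewrite ler_wpM2l ?subr_ge0// h2//; lra.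
have : s * (y / z - 1) + (1 - s) * (z^-1 - 1) = 0.
  rewrite (_ : _ + _ = z / z - 1); last by rewrite {3}/z; ring.
  by rewrite divff ?subrr// gt_eqF.
lra.
Qed.

(** * The mean of the ratio of the sizes before and after one round *)

Section SizeRatio.
Variables (R : realType) (n : nat) (K : {set 'I_n} -> {set 'I_n} -> R).
Hypothesis kernelK : round_kernel K.
Variables (S : {set 'I_n}) (c : R).
Hypotheses (S_gt0 : (0 < #|S|)%N) (c_ge0 : 0 <= c).

Local Notation k := (#|S|%:R : R).
Local Notation m := (round_mean K S (fun A => #|A|%:R)).
Hypothesis var_le :
  round_mean K S (fun A => (#|A|%:R - m) ^+ 2) <= (m - k) + c * k.

Let k_ge1 : 1 <= k. Proof. by rewrite ler1n. Qed.

Let card_ge (A : {set 'I_n}) : S \subset A -> k <= #|A|%:R.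
Proof. by move=> SA; rewrite ler_nat subset_leq_card. Qed.

Let mean_ge : k <= m.
Proof.
rewrite -[leLHS](round_mean_cst kernelK S); apply: le_round_mean => // A; exact: card_ge.
Qed.

(** Both ratio estimates use a quadratic in [#|A|] that lies above the ratio on sizes at least [k];
    its mean involves only [m] and the variance. *)
Let round_mean_le_quadratic (F : {set 'I_n} -> R) (u v w : R) : 0 <= w ->
  (forall A : {set 'I_n}, S \subset A -> F A <= u + v * #|A|%:R + w * (#|A|%:R - m) ^+ 2) ->
  round_mean K S F <= u + v * m + w * (m - k + c * k).
Proof.
move=> w0 /(le_round_mean kernelK)/le_trans; apply.
rewrite !round_meanD !round_meanZ (round_mean_cst kernelK).
by rewrite lerD2l ler_wpM2l.
Qed.

(** Expanding [k / Z] at [Z = m] gives its tangent line and the exact remainder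
    [(k / Z) * (Z - m) ^+ 2 / m ^+ 2], in which [k / Z <= 1]. *)
Lemma round_mean_ratio_le : round_mean K S (fun A => k / #|A|%:R) <= (k + 1 + c) / m.
Proof.
have k1 := k_ge1; have km := mean_ge; have m0 : 0 < m by lra.
have mV0 : 0 <= (m ^- 2) by rewrite invr_ge0 sqr_ge0.
apply: (@le_trans _ _ (2 * k / m + - (k / m ^+ 2) * m + m ^- 2 * (m - k + c * k))).
  apply: round_mean_le_quadratic => // A /card_ge.
  set Z := #|A|%:R; move=> kZ; have Z0 : 0 < Z by lra.
  rewrite -subr_ge0 (_ : _ - _ = (Z - m) ^+ 2 / m ^+ 2 * (1 - k / Z)); last first.
    by field; rewrite !gt_eqF.
  by rewrite mulr_ge0 ?divr_ge0 ?sqr_ge0// subr_ge0 ler_pdivrMr// mul1r.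
rewrite -subr_ge0 (_ : _ - _ = (k + c * (m - k)) / m ^+ 2); last first.
  by field; rewrite gt_eqF.
by rewrite divr_ge0 ?sqr_ge0// addr_ge0 ?mulr_ge0// subr_ge0.
Qed.

(** The preceding bound can exceed 1 when [k] is small. A majorant that is exact at [Z = k] gives a
    gain independent of [k]. *)
Lemma round_mean_ratio_lt1 (theta : R) : 0 < theta -> (1 + theta) * k <= m ->
  round_mean K S (fun A => k / #|A|%:R) <=
  1 - theta ^+ 2 / (2 * theta + theta ^+ 2 + c).
Proof.
move=> th0 thm; have k1 := k_ge1; have k0 : 0 < k by lra.
set nu := m / k - 1.
have mE : m = (1 + nu) * k by rewrite /nu addrC subrK divfK// gt_eqF.
have nuth : theta <= nu.
  by rewrite /nu lerBrDl ler_pdivlMr.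
have nu0 : 0 < nu by lra.
have W0 : 0 < 2 * nu + nu ^+ 2 + c.
  by rewrite ltr_wpDr// addr_gt0 ?exprn_gt0// mulr_gt0.
set W := 2 * nu + _ + _ in W0.
(* the tangent parameter minimising the resulting bound *)
set z := nu / W.
have z0 : 0 < z by rewrite divr_gt0.
(* The gain [nu ^+ 2 / W] increases with [nu], so the actual mean relative growth [nu] may be used
   in place of [theta]. *)
apply: (@le_trans _ _ (1 - nu ^+ 2 / W)); last first.
  rewrite lerD2l lerN2 ler_pdivrMr; last first.
    by rewrite ltr_wpDr// addr_gt0 ?exprn_gt0// mulr_gt0.
  rewrite mulrAC ler_pdivlMr// /W -subr_ge0.
  rewrite (_ : _ - _ = (nu - theta) * (2 * nu * theta + c * (nu + theta))); last by ring.
  by rewrite mulr_ge0 ?subr_ge0// addr_ge0 ?mulr_ge0//; lra.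
(* [q] meets [k / Z] at [Z = k] and touches it at [Z = k / z], so it lies above for all [Z >= k];
   [u] and [v] re-expand [q] around [m]. *)
pose q (Z : R) := 1 - 2 * z * (Z / k - 1) + z ^+ 2 * (Z / k) * (Z / k - 1).
pose u := 1 + 2 * z - z ^+ 2 * (1 + nu) ^+ 2.
pose v := - (2 * z / k) - z ^+ 2 / k + 2 * z ^+ 2 * (1 + nu) / k.
have qE Z : q Z = u + v * Z + (z ^+ 2 / k ^+ 2) * (Z - m) ^+ 2.
  by rewrite /q /u /v mE; field; rewrite gt_eqF.
have zk0 : 0 <= z ^+ 2 / k ^+ 2 by rewrite divr_ge0 ?sqr_ge0.
apply: le_trans (round_mean_le_quadratic (u := u) (v := v) zk0 _) _.
  move=> A /card_ge; set Z := #|A|%:R; move=> kZ; have Z0 : 0 < Z by lra.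
  rewrite -qE /q -subr_ge0.
  rewrite (_ : _ - _ = (Z - k) * (k / Z) / k * (1 - z * Z / k) ^+ 2); last first.
    by field; rewrite !gt_eqF.
  by rewrite mulr_ge0 ?sqr_ge0// !mulr_ge0 ?invr_ge0 ?subr_ge0// ltW.
rewrite /u /v mE.
have -> : 1 - nu ^+ 2 / W = 1 - 2 * z * nu + z ^+ 2 * W.
  by rewrite /z; field; rewrite gt_eqF.
(* What remains is replacing [(nu + c) / k] by [nu + c], which uses [k >= 1]. *)
rewrite -subr_ge0 /W.
rewrite [leRHS](_ : _ = z ^+ 2 * ((nu + c) * (k - 1)) / k); last first.
  by field; rewrite gt_eqF.
by rewrite divr_ge0 ?(ltW k0)// mulr_ge0 ?sqr_ge0// mulr_ge0 ?subr_ge0// addr_ge0// ltW.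
Qed.

End SizeRatio.

(* Up to the correction factor this is [(n / k) ^ s]. Under the correction, the
   term [1 / k] decreases by a constant factor per round and pays for the
   fluctuations of small informed sets; [- k / n] likewise pays for saturation. *)
Definition potential (R : realType) (s : R) (n k : nat) : R :=
  (n%:R / k%:R) `^ s * (1 + (k%:R^-1 - k%:R / n%:R) / 2).

(** * One-round decrease of the potential *)

Section Potential.
Variables (R : realType) (s : R) (n : nat).
Hypotheses (s_gt0 : 0 < s) (s_le : s <= 1 / 2).

Let s01 : 0 <= s <= 1.
Proof. by move: s_gt0 s_le => ? ?; apply/andP; split; lra. Qed.

Lemma potential_ge0 k : (k <= n)%N -> 0 <= potential s n k.
Proof.
move=> kn; rewrite mulr_ge0 ?powR_ge0//.
have : (k%:R / n%:R : R) <= 1.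
  have [->|n0] := posnP n; first by rewrite invr0 mulr0.
  by rewrite ler_pdivrMr ?ltr0n// mul1r ler_nat.
have : 0 <= k%:R^-1 :> R by rewrite invr_ge0.
lra.
Qed.

Lemma potential_ge_half k : (0 < k <= n)%N -> 1 / 2 <= potential s n k.
Proof.
move=> /andP[k0 kn]; have n0 : (0 < n)%N := leq_trans k0 kn.
have : (k%:R / n%:R : R) <= 1.
  by rewrite ler_pdivrMr ?ltr0n// mul1r ler_nat.
have : 0 <= k%:R^-1 :> R by rewrite invr_ge0.
have : 1 <= (n%:R / k%:R : R) `^ s.
  rewrite -[leLHS](powRr0 (n%:R / k%:R)) ler_powR ?(ltW s_gt0)//.
  by rewrite ler_pdivlMr ?ltr0n// mul1r ler_nat.
rewrite /potential; nra.
Qed.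

Lemma potential1_le : potential s n 1 <= 2 * n%:R `^ s.
Proof.
rewrite /potential !divr1 invr1 mulrC ler_wpM2r ?powR_ge0//.
have : 0 <= 1 / n%:R :> R by rewrite divr_ge0.
lra.
Qed.

(** The three summands of the potential are bounded separately with Bernoulli's inequality, in such
    a way that the bound is affine in [rho] and its mean can be taken. *)
Lemma potential_ratio (k z : nat) (g : R)
    (rho : R := k%:R / z%:R) (x : R := k%:R / n%:R) :
  (0 < k)%N -> (k <= z <= n)%N -> 0 <= g ->
  (1 + g) `^ s * potential s n z <= (n%:R / k%:R) `^ s *
    (1 + s * ((1 + g) * rho - 1) + ((1 + s * g) * rho / k%:R - x * (1 + (1 - rho) / 2)) / 2).
Proof.
move=> k0' /andP[kz zn] g0; have := s_gt0; have := s_le => s2 s0.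
have k0 : 0 < k%:R :> R by rewrite ltr0n.
have z0 : 0 < z%:R :> R by rewrite ltr0n (leq_trans k0').
have n0 : 0 < n%:R :> R by rewrite ltr0n (leq_trans _ zn)// (leq_trans k0').
have rho0 : 0 < rho by rewrite divr_gt0.
have rho1 : rho <= 1 by rewrite ler_pdivrMr// mul1r ler_nat.
have x0 : 0 < x by rewrite divr_gt0.
have nzE : n%:R / z%:R = n%:R / k%:R * rho by rewrite /rho; field; rewrite !gt_eqF.
have ziE : z%:R^-1 = rho / k%:R by rewrite /rho; field; rewrite !gt_eqF.
have znE : z%:R / n%:R = x / rho by rewrite /rho /x; field; rewrite !gt_eqF.
clearbody rho x.
rewrite /potential nzE powRM ?divr_ge0//; last exact: ltW.
rewrite -(mulrA (_ `^ s)) mulrCA ler_wpM2l ?powR_ge0// ziE znE.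
have Gs := powR_bernoulli (s := s) (mulr_gt0 (ltr_pwDl ltr01 g0) rho0) s01.
rewrite powRM in Gs; [|lra|lra].
have G_le := powR_bernoulli (s := s) (ltr_pwDl ltr01 g0) s01.
have s_le1 := powR_bernoulli (s := s) rho0 s01.
have tau_le : rho `^ (1 - s) <= 1 + (1 - s) * (rho - 1).
  by apply: powR_bernoulli => //; apply/andP; split; lra.
have G_ge1 : 1 <= (1 + g) `^ s.
  by rewrite -[leLHS](powRr0 (1 + g)) ler_powR ?(ltW s_gt0)//; lra.
have rhoE : rho `^ s * rho `^ (1 - s) = rho.
  have := @powRD _ rho s (1 - s).
  by rewrite (gt_eqF rho0) implybT addrC subrK (powRr1 (ltW rho0)) => <-.
have sig0 := powR_gt0 s rho0; have tau0 := powR_gt0 (1 - s) rho0.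
move: Gs G_le s_le1 tau_le G_ge1 rhoE sig0 tau0.
set G := _ `^ s; set sig := _ `^ s; set tau := _ `^ _.
move=> Gs G_le s_le1 tau_le G_ge1 rhoE sig0 tau0.
clearbody G sig tau.
have rho1' : 0 <= 1 - rho by lra.
have h1 : G * sig * (rho / k%:R) <= (1 + s * g) * rho / k%:R.
  rewrite -[leRHS]mulrA ler_wpM2r ?divr_ge0 ?(ltW rho0)//.
  have s10 : sig <= 1 by have := mulr_ge0 (ltW s_gt0) rho1'; lra.
  have G0 : 0 <= G by lra.
  have := ler_wpM2l G0 s10. lra.
(* As [sig * tau = rho], the saturation term carries [1 / tau]. With [y = (1 - rho) / 2],
   [s <= 1 / 2] gives [tau <= 1 - y], and [(1 + y) * (1 - y) <= 1]. *)
have h2 : x * (1 + (1 - rho) / 2) <= G * sig * (x / rho).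
  rewrite (_ : G * sig * (x / rho) = x * (G / tau)); last first.
    by rewrite -rhoE; field; rewrite !gt_eqF.
  rewrite ler_wpM2l ?(ltW x0)// ler_pdivlMr// (le_trans _ G_ge1)//.
  have tau_le' : tau <= 1 - (1 - rho) / 2.
    have s2' : 0 <= 1 / 2 - s by lra.
    have := mulr_ge0 s2' rho1'; lra.
  have h : 0 <= 1 + (1 - rho) / 2 by lra.
  have := ler_wpM2l h tau_le'.
  have := sqr_ge0 ((1 - rho) / 2); lra.
rewrite (_ : G * (sig * _) =
  G * sig + (G * sig * (rho / k%:R) - G * sig * (x / rho)) / 2); last by ring.
lra.
Qed.

Variables (K : {set 'I_n} -> {set 'I_n} -> R).
Hypothesis kernelK : round_kernel K.

(** Let [x = k / n]. With [4 * D * s = eta], the errors [s * D / k] and [s * D * x] are offset by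
    the gains [eta / (4 * k)] and [eta * x / 4] that [e <= 1 - eta] yields in the correction; only
    the error from [l] survives. *)
Lemma potential_step (S : {set 'I_n}) (g eta D l : R) :
  let k := #|S|%:R in
  let e := round_mean K S (fun A => k / #|A|%:R) in
  (0 < #|S|)%N -> 0 <= g <= D -> 0 < D -> 0 <= eta -> 4 * D * s = eta -> 0 <= l ->
  e <= 1 - eta -> (1 + g) * e <= 1 + D * (k^-1 + k / n%:R + l) ->
  (1 + g) `^ s * round_mean K S (fun A => potential s n #|A|) <=
  (1 + 2 * s * D * l) * potential s n #|S|.
Proof.
have := s_gt0; have := s_le => s2 s0.
move=> k e S0 /andP[g0 gD] D0 eta0 etaE l0 e_le ge_le.
have card_n (A : {set 'I_n}) : (#|A| <= n)%N by rewrite -[leqRHS]card_ord max_card.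
have k1 : 1 <= k by rewrite ler1n.
have k0 : 0 < k by lra.
have n0 : 0 < n%:R :> R by rewrite ltr0n (leq_trans S0).
have x1 : k / n%:R <= 1 by rewrite ler_pdivrMr// mul1r ler_nat.
have x0 : 0 < k / n%:R by rewrite divr_gt0.
have ki0 : 0 < k^-1 by rewrite invr_gt0.
set x := k / n%:R in x0 x1 ge_le *.
pose u : R := 1 - s - 3 / 4 * x.
pose v := s * (1 + g) + (1 + s * g) / k / 2 + x / 4.
rewrite -round_meanZ.
apply: (@le_trans _ _ (round_mean K S (fun A => (n%:R / k) `^ s * (u + v * (k / #|A|%:R))))).
  apply: le_round_mean => // A SA.
  apply: le_trans (potential_ratio S0 _ g0) _; first by rewrite subset_leq_card//=.
  rewrite ler_wpM2l ?powR_ge0// le_eqVlt; apply/orP; left; apply/eqP.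
  have A0 : 0 < #|A|%:R :> R by rewrite ltr0n (leq_trans S0)// subset_leq_card.
  by rewrite /u /v /x /k; field; rewrite !gt_eqF.
rewrite round_meanZ round_meanD round_mean_cst// round_meanZ -/e mulrCA /potential.
rewrite -/k -/x ler_wpM2l ?powR_ge0//.
have h1 : s * ((1 + g) * e) <= s * (1 + D * (k^-1 + x + l)) by rewrite ler_wpM2l ?(ltW s_gt0).
have h2 : x / 4 * e <= x / 4 * (1 - eta) by rewrite ler_wpM2l//; lra.
have sg : s * g <= eta / 4 by have := ler_wpM2l (ltW s_gt0) gD; lra.
have h3 : (1 + s * g) / k / 2 * e <= (1 - eta / 2) * k^-1 / 2.
  rewrite (_ : _ * e = (1 + s * g) * e * k^-1 / 2); last by ring.
  rewrite ler_pM2r ?invr_gt0// ler_pM2r//.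
  have sg0 : 0 <= 1 + s * g by rewrite addr_ge0// mulr_ge0// ltW.
  have := ler_wpM2l sg0 e_le.
  have := mulr_ge0 (ltW s_gt0) g0; have := mulr_ge0 (mulr_ge0 (ltW s_gt0) g0) eta0; lra.
(* This accounts for the factor 2 in the conclusion: the correction factor of the potential is at
   least [1 / 2]. *)
have h4 : 0 <= (s * D * l) * (k^-1 + 1 - x).
  by rewrite mulr_ge0 ?(mulr_ge0, ltW s_gt0, ltW D0)//; lra.
clearbody e x k; rewrite /u /v; move: h1 h2 h3 h4; rewrite -etaE; lra.
Qed.

End Potential.

(** * The probability of staying below the threshold *)

Lemma fsbigT (R : Type) (idx : R) (op : Monoid.com_law idx) (I : finType) (F : I -> R) :
  \big[op/idx]_(i \in [set: I]) F i = \big[op/idx]_(i : I) F i.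
Proof.
have finT := @finite_finset I setT; rewrite fsbig_finite//.
apply: perm_big; apply: uniq_perm; rewrite ?finmap.fset_uniq ?index_enum_uniq//.
by move=> i; rewrite in_fset_set// mem_index_enum; apply/mem_set.
Qed.

Definition below (R : realType) (Om : Type) (n : nat) (X : nat -> Om -> {set 'I_n})
    (m : R) (t0 t1 : nat) : set Om :=
  [set w | forall i, (t0 <= i < t1)%N -> #|X i w|%:R < m].

Section Survival.
Variables (R : realType) (d : measure_display) (Om : measurableType d).
Variables (P : probability Om R) (n : nat).
Variables (K : {set 'I_n} -> {set 'I_n} -> R) (X : nat -> Om -> {set 'I_n}).
Hypotheses (kernelK : round_kernel K) (procX : rumor_process P K X).
Variable m : R.

Let path (t : nat) (h : nat -> {set 'I_n}) : set Om :=
  [set w | forall i, (i <= t)%N -> X i w = h i].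

Lemma measurable_below t0 t1 : measurable (below X m t0 t1).
Proof.
have [mX _ _] := procX.
rewrite (_ : below X m _ _ = \bigcap_(i in [set i | (t0 <= i < t1)%N])
  \bigcup_(A in [set A : {set 'I_n} | #|A|%:R < m]) [set w | X i w = A]).
  apply: bigcap_measurableType => i _; apply: fin_bigcup_measurable => [|A _]; last exact: mX.
  exact: (@finite_finset {set 'I_n}).
apply/seteqP; split=> w /= h i /= /h; last by case=> A /= Am ->.
by exists (X i w).
Qed.

Let measurable_path t h : measurable (path t h).
Proof.
have [mX _ _] := procX.
rewrite (_ : path t h = \bigcap_(i in [set i | (i <= t)%N]) [set w | X i w = h i]).
  exact: bigcap_measurableType.
by apply/seteqP; split.
Qed.

Let measurable_path_below t h t0 t1 : measurable (path t h `&` below X m t0 t1).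
Proof. apply: measurableI; [exact: measurable_path|exact: measurable_below]. Qed.

Lemma measure_le_fin_sum (I : finType) (A : set Om) (F : I -> set Om) (r : I -> \bar R) :
  measurable A -> (forall i, measurable (F i)) -> A `<=` \bigcup_i F i ->
  (forall i, P (F i) <= r i)%E -> (P A <= \sum_i r i)%E.
Proof.
move=> mA mF AF Pr; apply: (@le_trans _ _ (\sum_i P (F i))%E); last exact: lee_sum.
by rewrite -fsbigT; apply: content_sub_fsum => //; exact: (@finite_finset I).
Qed.

Variables (V : {set 'I_n} -> R) (q : R).
Hypotheses (V_ge0 : forall A, 0 <= V A) (q_ge0 : 0 <= q).
Hypothesis V_ge : forall A : {set 'I_n}, (0 < #|A|)%N -> #|A|%:R < m -> 1 / 2 <= V A.
Hypothesis V_step : forall S : {set 'I_n}, (0 < #|S|)%N -> #|S|%:R < m ->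
  round_mean K S V <= q * V S.

(** Supermartingale bound for the chain killed at the threshold, by induction on the window length
    [j], splitting on the next set. Keeping [P (path t h)] as a factor avoids conditioning on null
    events. *)
Let path_below (j t : nat) (h : nat -> {set 'I_n}) : (0 < #|h t|)%N -> #|h t|%:R < m ->
  (P (path t h `&` below X m t.+1 (t.+1 + j)) <= P (path t h) * (2 * q ^+ j * V (h t))%:E)%E.
Proof.
have [_ _ markov] := procX.
elim: j t h => [|j IH] t h h0 hm.
  apply: (@le_trans _ _ (P (path t h))).
    apply: le_measure; rewrite ?inE;
      [exact: measurable_path_below|exact: measurable_path|by move=> w []].
  rewrite -[leLHS]mule1 lee_wpmul2l// lee_fin expr0 mulr1.
  have := V_ge h0 hm; lra.
pose ext (A : {set 'I_n}) (i : nat) := if (i <= t)%N then h i else A.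
have extS A : ext A t.+1 = A by rewrite /ext ltnn.
have path_ext A : path t (ext A) = path t h.
  by apply/seteqP; split=> w /= hw i it; have := hw i it; rewrite /ext it.
have [K_ge0 _ K_sub] := kernelK (h t).
(* A next set that has reached the threshold is outside the window event and contributes nothing. *)
pose F (A : {set 'I_n}) := if #|A|%:R < m
  then path t.+1 (ext A) `&` below X m t.+2 (t.+2 + j) else set0.
apply: (@le_trans _ _
    (\sum_(A : {set 'I_n}) P (path t h) * (2 * q ^+ j * (K (h t) A * V A))%:E)%E).
  apply: (@measure_le_fin_sum _ _ F).
  - exact: measurable_path_below.
  - move=> A; rewrite /F; case: ifP => // _; exact: measurable_path_below.
  - move=> w [hw bw]; exists (X t.+1 w) => //=.
    rewrite /F bw; last by rewrite leqnn addSn ltnS addnS ltnS leq_addr.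
    split=> [i|i /andP[ti itj]].
      rewrite leq_eqVlt => /predU1P[->|]; first by rewrite extS.
      by rewrite ltnS /ext => it; rewrite it hw.
    by apply: bw; rewrite (ltnW ti) addnS -addSn.
  - move=> A; rewrite /F; case: ifPn => Am; last first.
      rewrite measure0 mule_ge0// lee_fin.
      by rewrite mulr_ge0 ?mulr_ge0 ?exprn_ge0.
    have pathS : P (path t.+1 (ext A)) = (P (path t h) * (K (h t) A)%:E)%E.
      have := markov t (ext A); rewrite -/(path t (ext A)) path_ext extS.
      by rewrite {2}/ext leqnn.
    have [hA|hA] := boolP (h t \subset A).
      apply: le_trans (IH _ _ _ _) _; rewrite ?extS//.
        by rewrite (leq_trans h0)// subset_leq_card.
      rewrite pathS -muleA -EFinM le_eqVlt; apply/orP; left; apply/eqP.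
      by congr (_ * _%:E)%E; ring.
    (* Sets not containing [h t] have transition probability 0; they may be empty, so the induction
       hypothesis is not applied to them. *)
    rewrite K_sub// mul0r mulr0 mule0.
    apply: (@le_trans _ _ (P (path t.+1 (ext A)))).
      apply: le_measure; rewrite ?inE;
      [exact: measurable_path_below|exact: measurable_path|by move=> w []].
    by rewrite pathS K_sub// mule0.
rewrite -ge0_sume_distrr; last first.
  by move=> A _; rewrite lee_fin mulr_ge0 ?mulr_ge0 ?exprn_ge0.
rewrite lee_wpmul2l// sumEFin lee_fin -big_distrr /= exprSr -!mulrA.
by rewrite ler_wpM2l// ler_wpM2l ?exprn_ge0//; exact: V_step.
Qed.

(** The starting set may be random, so the bound is summed over its values, whose probabilities add
    up to at most 1. *)
Lemma survival_le (v : R) (t : nat) : 0 <= v ->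
  (forall A : {set 'I_n}, #|A| = 1%N -> V A <= v) ->
  (P (below X m 0 t.+1) <= (2 * q ^+ t * v)%:E)%E.
Proof.
move=> v0 Vv; have [mX X0 _] := procX.
pose F (A : {set 'I_n}) := if (#|A| == 1%N) && (#|A|%:R < m)
  then path 0 (fun=> A) `&` below X m 1 (1 + t) else set0.
apply: (@le_trans _ _ (\sum_(A : {set 'I_n})
    (2 * q ^+ t * v)%:E * P [set w | X 0%N w = A])%E).
  apply: (@measure_le_fin_sum _ _ F).
  - exact: measurable_below.
  - move=> A; rewrite /F; case: ifP => // _; exact: measurable_path_below.
  - move=> w bw; exists (X 0%N w) => //; rewrite /F (bw 0%N isT) X0 eqxx/=.
    split=> [i|i /andP[i0 it]]; first by rewrite leqn0 => /eqP ->.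
    by apply: bw; rewrite it.
  - move=> A; rewrite /F; case: ifPn => [/andP[/eqP A1 Am]|_]; last first.
      by rewrite measure0 mule_ge0// lee_fin mulr_ge0 ?mulr_ge0 ?exprn_ge0.
    apply: le_trans (path_below _ _ _) _; rewrite ?A1 -?A1//.
    rewrite muleC (_ : path 0 _ = [set w | X 0%N w = A]); last first.
      apply/seteqP; split=> w /=; first exact.
      by move=> Xw i; rewrite leqn0 => /eqP ->.
    by rewrite lee_wpmul2r// lee_fin ler_wpM2l ?mulr_ge0 ?exprn_ge0// Vv.
rewrite -ge0_sume_distrr; last by move=> A _.
rewrite -[leRHS]mule1 lee_wpmul2l//.
  by rewrite lee_fin mulr_ge0 ?mulr_ge0 ?exprn_ge0.
rewrite -fsbigT -measure_fin_bigcup//.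
- apply: probability_le1; apply: fin_bigcup_measurable => [|A _]; last exact: mX.
  exact: (@finite_finset {set 'I_n}).
- exact: (@finite_finset {set 'I_n}).
- by move=> A B _ _ [w [/= <- <-]].
Qed.

End Survival.

(** * The spreading time in terms of survival events *)

Section SpreadingTime.
Variables (R : realType) (Om : Type) (n : nat) (X : nat -> Om -> {set 'I_n}) (m : R).

Lemma spreading_time_le w t : m <= #|X t w|%:R ->
  (spreading_time X m w <= (t%:R : R)%:E)%E.
Proof. by move=> Xt; apply: ereal_inf_lbound; exists t. Qed.

Lemma spreading_time_gt (a : R) : 0 <= a ->
  [set w | (a%:E < spreading_time X m w)%E] = below X m 0 (Num.trunc a).+1.
Proof.
move=> a0; apply/seteqP; split=> w /= h.
  move=> i; rewrite leq0n ltnS/= truncn_ge_nat// => ia; rewrite ltNge; apply/negP => Xi.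
  by have := lt_le_trans h (spreading_time_le Xi); rewrite lte_fin ltNge ia.
apply: (@lt_le_trans _ _ ((Num.trunc a).+1%:R)%:E).
  by rewrite lte_fin truncnS_gt.
apply: le_ereal_inf_tmp => _ [t [Xt ->]]; rewrite lee_fin ler_nat leqNgt.
by apply/negP => ta; have := h t ta; rewrite ltNge Xt.
Qed.

(** Layer-cake formula for a time with values in the naturals and [+oo]: the [t]-th indicator is
    that of the spreading time exceeding [t]. *)
Lemma spreading_time_series w :
  spreading_time X m w = (\sum_(0 <= t <oo) (\1_(below X m 0 t.+1) w)%:E)%E.
Proof.
have ind0 t : (0 <= (\1_(below X m 0 t.+1) w : R)%:E)%E by rewrite lee_fin.
apply/eqP; rewrite eq_le; apply/andP; split.
  (* If the threshold is never reached, [lb] applies to every [t] and the series is infinite;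
     otherwise it is used at the first time [t0] of reaching it. *)
  have lb t : below X m 0 t w ->
      ((t%:R : R)%:E <= \sum_(0 <= t <oo) (\1_(below X m 0 t.+1) w)%:E)%E.
    move=> bt; apply: le_trans (nneseries_lim_ge t _) => //.
    rewrite (eq_big_nat _ _ (F2 := fun=> 1%:E)); last first.
      move=> i /andP[_ it]; rewrite indicE mem_set// => j /andP[j0 ji].
      by apply: bt; rewrite j0 (leq_trans ji).
    by rewrite sumEFin lee_fin sumr_const_nat subn0.
  have [[t Xt]|noX] := pselect (exists t, m <= #|X t w|%:R); last first.
    rewrite [leRHS]eq_infty ?leey// => r.
    apply: le_trans (lb (Num.trunc r).+1 _).
      by rewrite lee_fin ltW// truncnS_gt.
    by move=> i _; rewrite ltNge; apply/negP => Xi; apply: noX; exists i.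
  have ex : exists t, m <= #|X t w|%:R by exists t.
  case: (ex_minnP ex) => t0 Xt0 t0min.
  apply: le_trans (spreading_time_le Xt0) (lb _ _) => i /andP[_ it0].
  by rewrite ltNge; apply: contraL it0 => /t0min; rewrite -leqNgt.
apply: le_ereal_inf_tmp => _ [t [Xt ->]].
apply: lime_le; first exact: is_cvg_nneseries.
near=> N; have tN : (t <= N)%N by near: N; exact: nbhs_infty_ge.
rewrite (big_cat_nat (n := t))//= [X in (_ + X)%E]big_nat [X in (_ + X)%E]big1; last first.
  move=> i /andP[ti _]; rewrite indicE memNset// => /(_ t).
  by rewrite ltNge Xt leq0n ltnS ti => /(_ isT).
rewrite adde0 sumEFin lee_fin; apply: (@le_trans _ _ (\sum_(0 <= i < t) 1)).
  by apply: ler_sum => i _; rewrite indicE lern1 leq_b1.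
by rewrite sumr_const_nat subn0.
Unshelve. all: by end_near.
Qed.

End SpreadingTime.

Lemma nneseries_geometric_le (R : realType) (a z : R) : 0 <= a -> 0 <= z < 1 ->
  (\sum_(0 <= i <oo) (a * z ^+ i)%:E <= (a / (1 - z))%:E)%E.
Proof.
move=> a0 /andP[z0 z1]; have z1' : 0 < 1 - z by rewrite subr_gt0.
apply: lime_le.
  by apply: is_cvg_nneseries => i _ _; rewrite lee_fin mulr_ge0 ?exprn_ge0.
near=> N; rewrite sumEFin lee_fin.
have := geometric_seriesE a (negbT (lt_eqF z1)); rewrite /series /= => /(congr1 (@^~ N)) ->.
by rewrite ler_pM2r ?invr_gt0// ler_piMr// lerBlDr lerDl exprn_ge0.
Unshelve. all: by end_near.
Qed.

(** * Tail and mean of the spreading time from an exponential survival bound *)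

Section Expectation.
Variables (R : realType) (d : measure_display) (Om : measurableType d).
Variables (P : probability Om R) (n : nat).
Variables (K : {set 'I_n} -> {set 'I_n} -> R) (X : nat -> Om -> {set 'I_n}).
Hypothesis procX : rumor_process P K X.
Variables (m L A alpha : R).
Hypotheses (L_ge0 : 0 <= L) (A_ge0 : 0 <= A) (alpha_gt0 : 0 < alpha).
Hypothesis survival_tail : forall t : nat, L - 1 <= t%:R ->
  (P (below X m 0 t.+1) <= (A * expR (- alpha * (t%:R - L)))%:E)%E.

(** The integer part of [L + r] exceeds [L + r - 1]: this rounding costs the factor [expR alpha] and
    is why [survival_tail] starts at [L - 1]. *)
Lemma spreading_time_tail (r : nat) :
  (P [set w | ((L + r%:R)%:E < spreading_time X m w)%E]
     <= (A * expR alpha * expR (- alpha * r%:R))%:E)%E.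
Proof.
have [L0 al0] := (L_ge0, alpha_gt0).
have r0 : 0 <= r%:R :> R by [].
have Lr0 : 0 <= L + r%:R by rewrite addr_ge0.
rewrite spreading_time_gt//.
have := truncnS_gt (L + r%:R); rewrite -natr1 => tr.
apply: le_trans (survival_tail _) _; first lra.
rewrite lee_fin -mulrA -expRD ler_wpM2l// ler_expR.
rewrite (_ : alpha + _ = - alpha * (r%:R - 1)); last by ring.
by rewrite ler_wnM2l ?oppr_le0 ?(ltW al0)//; lra.
Qed.

(** In the tail sum, the terms up to the integer part of [L] are at most 1 each, [L + 1] in total;
    the later ones are dominated by a geometric series. *)
Lemma spreading_time_mean :
  (\int[P]_w spreading_time X m w <= (L + (1 + A / (1 - expR (- alpha))))%:E)%E.
Proof.
have [L0 al0] := (L_ge0, alpha_gt0).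
have mB t : measurable (below X m 0 t.+1) by exact: measurable_below procX _ _ _.
under eq_integral do rewrite spreading_time_series.
rewrite integral_nneseries//; last first.
  by move=> t; apply/measurable_EFinP; exact: measurable_indic.
under eq_eseriesr do rewrite integral_indic// setIT.
set N := (Num.trunc L).+1.
rewrite (nneseries_split 0 N)// add0n addrA EFinD; apply: leeD.
  apply: (@le_trans _ _ (\sum_(0 <= t < N) 1)%E).
    by apply: lee_sum => t _; exact: probability_le1.
  rewrite sumEFin lee_fin sumr_const_nat subn0 -natr1 lerD2r.
  by rewrite truncn_le.
rewrite -nneseries_addn//.
have ez : 0 <= expR (- alpha) < 1 by rewrite expR_ge0 expR_lt1 oppr_lt0.
apply: le_trans (nneseries_geometric_le A_ge0 ez).
apply: lee_nneseries => [t _ _|t _]; first exact: measure_ge0.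
have LN : L < N%:R := truncnS_gt L.
have t0 : 0 <= t%:R :> R by [].
apply: le_trans (survival_tail _) _; first by rewrite natrD; lra.
rewrite lee_fin ler_wpM2l// -expRM_natl ler_expR natrD [leRHS]mulrC.
by rewrite ler_wnM2l ?oppr_le0 ?(ltW al0)//; lra.
Qed.

End Expectation.

(** * The decrease under the growth conditions and the resulting survival bound *)

Section GrowthRegime.
Variables (R : realType) (n : nat) (K : {set 'I_n} -> {set 'I_n} -> R) (p : nat -> R).
Hypotheses (kernelK : round_kernel K) (homK : homogeneous K p).
Variables (g gmin gmax a b c f : R).
Hypotheses (gmin_gt0 : 0 < gmin) (g_bnd : gmin <= g <= gmax).
Hypotheses (a_ge0 : 0 <= a) (b_ge0 : 0 <= b) (c_ge0 : 0 <= c).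
Hypotheses (f_lt1 : f < 1) (af_lt1 : a * f < 1).
Hypotheses (lnn_gt0 : 0 < ln n%:R :> R) (b_small : b / ln n%:R <= (1 - a * f) / 2).
Hypothesis growth : forall k : nat, (1 <= k)%N -> k%:R < f * n%:R ->
  g * (k%:R / n%:R) * (1 - a * (k%:R / n%:R) - b / ln n%:R) <= p k /\
  (covariance_number K k <= (c * (k%:R / n%:R ^+ 2))%:E)%E.

(** [theta] bounds from below, uniformly in [n] and [k], the mean relative growth below [f * n];
    [eta] is the gain it yields in [round_mean_ratio_lt1]; [D] dominates the error coefficients of
    the ratio. *)
Let theta : R := gmin * (1 - f) * ((1 - a * f) / 2).
Let eta : R := theta ^+ 2 / (2 * theta + theta ^+ 2 + c).
Let D : R := (1 + gmax) * (a + b + c + 1).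

Lemma growth_step (s : R) (S : {set 'I_n}) : 0 < s -> s <= 1 / 2 -> 4 * D * s = eta ->
  (0 < #|S|)%N -> #|S|%:R < f * n%:R ->
  (1 + g) `^ s * round_mean K S (fun A => potential s n #|A|) <=
  (1 + 2 * s * D * (ln n%:R)^-1) * potential s n #|S|.
Proof.
move=> s0 s2 sE S0 Sf.
have [g1 g2] := andP g_bnd; have gm0 := gmin_gt0.
have [a0 b0] := (a_ge0, b_ge0); have c0 := c_ge0.
have f1 := f_lt1; have af1 := af_lt1.
have g0 : 0 <= g by lra.
have g10 : 0 <= 1 + g by lra.
have gm10 : 0 < 1 + gmax by lra.
have abc0 : 0 < a + b + c + 1 by lra.
have [c10 a10] : 0 <= 1 + c /\ 0 <= a + 1 by split; lra.
have c1D : 1 + c <= a + b + c + 1 by lra.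
have a1D : a + 1 <= a + b + c + 1 by lra.
have bD : b <= a + b + c + 1 by lra.
have D1 : 1 <= a + b + c + 1 by lra.
have f10 : 0 < 1 - f by lra.
have af10 : 0 < (1 - a * f) / 2 by lra.
have D0 : 0 < D by rewrite mulr_gt0.
have D_ge w : 0 <= w -> w <= a + b + c + 1 -> (1 + g) * w <= D.
  by move=> w0 w1; apply: ler_pM => //; rewrite lerD2l.
have gD : g <= D by have := D_ge 1 ler01 D1; rewrite mulr1; apply: le_trans; rewrite lerDr.
have l0 := lnn_gt0; have bs := b_small.
have n0 : 0 < n%:R :> R by rewrite ltr0n (leq_trans S0)// -[leqRHS]card_ord max_card.
have [p_ge cov_le] := growth S0 Sf.
have v0 : 0 <= c * (#|S|%:R / n%:R ^+ 2) by rewrite !mulr_ge0.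
have var := round_var_card kernelK homK S0 v0 cov_le.
have meanE := round_mean_card kernelK homK S0.
set m := round_mean K S (fun A => #|A|%:R) in var meanE.
have k1 : 1 <= #|S|%:R :> R by rewrite ler1n.
set k : R := #|S|%:R in k1 Sf p_ge v0 var meanE.
pose x : R := k / n%:R.
have kE : k = x * n%:R by rewrite /x divfK// gt_eqF.
have k0 : 0 < k by lra.
have x0 : 0 < x by rewrite divr_gt0.
have xf : x <= f by rewrite ler_pdivrMr// ltW.
(* Here [(n - k) * p #|S| = m - k], and the covariance part is [(1 - x) * (c * k)]. *)
have var_le : round_mean K S (fun A => (#|A|%:R - m) ^+ 2) <= (m - k) + c * k.
  apply: le_trans var _; rewrite meanE -subr_ge0.
  rewrite (_ : _ - _ = x * (c * k)); last first.
    by rewrite /x; field; rewrite gt_eqF.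
  by rewrite mulr_ge0 ?(ltW x0)// mulr_ge0 ?(ltW k0).
have ax : a * x <= a * f by rewrite ler_wpM2l.
have gx0 : 0 <= g * x by rewrite mulr_ge0// ltW.
have m_ge : k + g * k * (1 - x) * (1 - a * x - b / ln n%:R) <= m.
  rewrite meanE lerD2l.
  have nk0 : 0 <= n%:R - k by rewrite kE -{1}[n%:R]mul1r -mulrBl mulr_ge0//; lra.
  apply: le_trans (ler_wpM2l nk0 p_ge); rewrite -/x le_eqVlt; apply/orP; left.
  by apply/eqP; rewrite kE; ring.
have theta0 : 0 < theta by rewrite /theta mulr_gt0// mulr_gt0.
have fx : 1 - f <= 1 - x by rewrite lerB.
have afx : (1 - a * f) / 2 <= 1 - a * x - b / ln n%:R by lra.
have m_theta : (1 + theta) * k <= m.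
  apply: le_trans m_ge; rewrite mulrDl mul1r lerD2l.
  rewrite (_ : theta * k = gmin * k * (1 - f) * ((1 - a * f) / 2)); last first.
    by rewrite /theta; ring.
  have gk : gmin * k <= g * k by rewrite ler_pM2r.
  have gk0 : 0 <= gmin * k by rewrite mulr_ge0// ltW.
  apply: ler_pM => //; [by rewrite mulr_ge0// ltW|exact: ltW|].
  by apply: ler_pM => //; exact: ltW.
have m_ge_k : k <= m.
  by apply: le_trans m_theta; rewrite ler_peMl ?(ltW k0)// lerDl ltW.
have bl0 : 0 <= b / ln n%:R by rewrite divr_ge0// ltW.
(* [eps] collects the relative losses: [(1 - x) * (1 - a * x - b / ln n)] is at least [1 - eps]. *)
pose eps : R := (a + 1) * x + b / ln n%:R.
have eps0 : 0 <= eps by rewrite addr_ge0// mulr_ge0// ltW.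
have geps0 : 0 <= g * eps by rewrite mulr_ge0.
have m_eps : k + g * k - g * eps * k <= m.
  apply: le_trans m_ge; rewrite -subr_ge0.
  rewrite (_ : _ - _ = g * x * k * (a * x + b / ln n%:R)); last by rewrite /eps; ring.
  have ax0 : 0 <= a * x by rewrite mulr_ge0// ltW.
  by rewrite mulr_ge0 ?(mulr_ge0 gx0)// addr_ge0.
have m0 : 0 < m := lt_le_trans k0 m_ge_k.
apply: (potential_step s0 s2 kernelK S0 (eta := eta)) => //.
- by rewrite g0.
- have th2 : 0 <= 2 * theta by rewrite mulr_ge0// ltW.
  by rewrite divr_ge0 ?sqr_ge0// addr_ge0// addr_ge0// sqr_ge0.
- by rewrite invr_ge0 ltW.
- exact: round_mean_ratio_lt1.
rewrite -/k -/x; set l := (ln n%:R)^-1.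
have ll0 : 0 < l by rewrite invr_gt0.
apply: le_trans (ler_wpM2l g10 (round_mean_ratio_le kernelK S0 c0 var_le)) _.
(* From [(1 + g) * k <= m + g * eps * k] and [k <= m] follows [(1 + g) * k / m <= 1 + g * eps]. *)
apply: (@le_trans _ _ ((1 + g * eps) + (1 + g) * (1 + c) * k^-1)).
  rewrite [leLHS](_ : _ = (1 + g) * k / m + (1 + g) * (1 + c) * m^-1); last by rewrite -/k; ring.
  apply: lerD.
    rewrite ler_pdivrMr//; have := ler_wpM2l geps0 m_ge_k; lra.
  by rewrite ler_wpM2l ?lef_pV2 ?posrE// mulr_ge0.
rewrite -addrA lerD2l -/l.
have h1 : (1 + g) * (1 + c) * k^-1 <= D * k^-1.
  by rewrite ler_wpM2r ?invr_ge0 ?(ltW k0)// D_ge.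
have h2 : (1 + g) * (a + 1) * x <= D * x.
  by rewrite ler_wpM2r ?(ltW x0)// D_ge.
have h3 : (1 + g) * b * l <= D * l.
  by rewrite ler_wpM2r ?(ltW ll0)// D_ge.
have h4 : g * eps <= (1 + g) * (a + 1) * x + (1 + g) * b * l.
  rewrite -mulrA -[(1 + g) * b * l]mulrA -mulrDr -/eps.
  by rewrite mulrDl mul1r lerDr.
lra.
Qed.

Variables (d : measure_display) (Om : measurableType d) (P : probability Om R).
Variable X : nat -> Om -> {set 'I_n}.
Hypothesis procX : rumor_process P K X.
Hypothesis D_small : 2 * D / ln n%:R <= ln (1 + gmin) / 2.

Let s : R := eta / (4 * D).
Let L : R := log_base (1 + g) n%:R.

(** Over [L] rounds the factors [1 + O(1 / ln n)] accumulate only to a constant, as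
    [L / ln n = 1 / ln (1 + g)], and [n ^ s] equals [(1 + g) ^ (s * L)]. *)
Lemma growth_survival (t : nat) : L - 1 <= t%:R ->
  (P (below X (f * n%:R) 0 t.+1) <=
   (4 * expR (2 * s * D / ln (1 + gmin) + s * ln (1 + gmax))
      * expR (- (s * ln (1 + gmin) / 2) * (t%:R - L)))%:E)%E.
Proof.
move=> Lt.
have [g1 g2] := andP g_bnd; have gm0 := gmin_gt0.
have [a0 b0] := (a_ge0, b_ge0); have c0 := c_ge0.
have f1 := f_lt1; have af1 := af_lt1.
have l0 := lnn_gt0.
have n1 : 1 <= n%:R :> R.
  by rewrite leNgt; apply/negP => n1; have := ln_le0 (ltW n1); lra.
have n0 : 0 < n%:R :> R by lra.
have theta0 : 0 < theta by rewrite /theta !mulr_gt0//; lra.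
have D1 : 1 <= D by rewrite /D -[leLHS]mulr1 ler_pM//; lra.
have eta_den : 0 < 2 * theta + theta ^+ 2 + c.
  by rewrite ltr_wpDr// addr_gt0 ?exprn_gt0// mulr_gt0.
have eta0 : 0 < eta by rewrite divr_gt0 ?exprn_gt0.
have eta1 : eta <= 1 by rewrite ler_pdivrMr//; lra.
have s0 : 0 < s by rewrite divr_gt0//; lra.
have sE : 4 * D * s = eta by rewrite /s mulrC divfK// gt_eqF//; lra.
have s2 : s <= 1 / 2.
  rewrite /s ler_pdivrMr; lra.
have G0 : 0 < (1 + g) `^ s by rewrite powR_gt0; lra.
pose q : R := (1 + 2 * s * D * (ln n%:R)^-1) / (1 + g) `^ s.
have D0 : 0 <= D by lra.
have sD0 : 0 <= 2 * s * D by have := mulr_ge0 (ltW s0) D0; lra.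
have li0 : 0 <= (ln n%:R)^-1 :> R by rewrite invr_ge0 ltW.
have sDl0 := mulr_ge0 sD0 li0.
have q0 : 0 <= q by rewrite divr_ge0 ?(ltW G0)//; lra.
have card_n (A : {set 'I_n}) : (#|A| <= n)%N by rewrite -[leqRHS]card_ord max_card.
have ns0 := powR_ge0 n%:R s.
apply: (le_trans (survival_le kernelK procX (V := fun A => potential s n #|A|)
  (q := q) (v := 2 * n%:R `^ s) (m := f * n%:R) _ q0 _ _ t _ _)).
- by move=> A; exact: potential_ge0.
- by move=> A A0 _; apply: potential_ge_half => //; rewrite A0 card_n.
- move=> S S0 Sf; rewrite /q mulrAC ler_pdivlMr// mulrC.
  exact: growth_step.
- by rewrite mulr_ge0.
- by move=> A ->; exact: potential1_le.
rewrite lee_fin.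
have lg_min : 0 < ln (1 + gmin) by rewrite ln_gt0//; lra.
have lg_ge : ln (1 + gmin) <= ln (1 + g) by rewrite ler_ln ?posrE; lra.
have lg_le : ln (1 + g) <= ln (1 + gmax) by rewrite ler_ln ?posrE; lra.
set lg := ln (1 + g) in lg_ge lg_le; set l1 := ln (1 + gmin) in lg_min lg_ge *.
have lg0 : 0 < lg by lra.
pose l := (ln n%:R)^-1 : R.
(* [beta] is the decay rate per round; [D_small] keeps it at least [s * l1 / 2]. *)
pose beta : R := s * (lg - 2 * D * l).
have qE : q <= expR (- beta).
  rewrite /q ler_pdivrMr// /powR gt_eqF; last by lra.
  rewrite -expRD (_ : - beta + _ = 2 * s * D * l); last by rewrite /beta -/lg; ring.
  exact: expR_ge1Dx.
have qt : q ^+ t <= expR (- (beta * t%:R)).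
  rewrite -mulNr mulrC expRM_natl; apply: lerXn2r; rewrite ?nnegrE ?expR_ge0//.
have nsE : n%:R `^ s = expR (s * ln n%:R :> R) by rewrite /powR gt_eqF.
have LE : ln n%:R = L * lg by rewrite /L /log_base divfK// gt_eqF.
have lL : l * L = lg^-1.
  by rewrite /l /L /log_base -/lg; field; rewrite !gt_eqF.
rewrite (_ : 2 * q ^+ t * (2 * n%:R `^ s) = 4 * (q ^+ t * n%:R `^ s)); last by ring.
rewrite -mulrA ler_wpM2l// nsE -expRD.
apply: le_trans (ler_wpM2r (expR_ge0 _) qt) _.
rewrite -expRD ler_expR LE.
have beta_ge : s * l1 / 2 <= beta.
  rewrite /beta -mulrA ler_wpM2l ?(ltW s0)//; have := D_small; rewrite -/l -/l1; lra.
have beta_le : beta <= s * ln (1 + gmax).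
  rewrite /beta ler_wpM2l ?(ltW s0)//.
  have := mulr_ge0 D0 li0; rewrite -/l; lra.
have -> : - (beta * t%:R) + s * (L * lg) = 2 * s * D * (l * L) - beta * (t%:R - L).
  by rewrite /beta; ring.
rewrite lL -addrA; apply: lerD.
  by rewrite ler_wpM2l ?lef_pV2 ?posrE.
have l1s := mulr_ge0 (ltW s0) (ltW lg_min).
(* For [t < L], passing from [beta] to the smaller rate loses something; as [t >= L - 1], the loss
   is at most [beta], which [s * ln (1 + gmax)] covers. *)
have h1 : 0 <= beta - s * l1 / 2 by lra.
have h2 : 0 <= t%:R - L + 1 by lra.
have := mulr_ge0 h1 h2; lra.
Qed.

End GrowthRegime.

(** * Uniform constants and the two claims *)

Theorem theorem21 (R : realType)
    (gamma : nat -> R) (gmin gmax a b c f : R)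
    (gmin_gt0 : 0 < gmin)
    (gamma_bnd : forall n : nat, gmin <= gamma n <= gmax)
    (a_ge0 : 0 <= a) (b_ge0 : 0 <= b) (c_ge0 : 0 <= c)
    (f_gt0 : 0 < f) (f_lt1 : f < 1) (af_lt1 : a * f < 1)
    (d : nat -> measure_display)
    (Om : forall n : nat, measurableType (d n))
    (P : forall n : nat, probability (Om n) R)
    (K : forall n : nat, {set 'I_n} -> {set 'I_n} -> R)
    (p : nat -> nat -> R)
    (X : forall n : nat, nat -> Om n -> {set 'I_n})
    (kernelK : forall n : nat, (0 < n)%N -> round_kernel (K n))
    (homK : forall n : nat, (0 < n)%N -> homogeneous (K n) (p n))
    (procX : forall n : nat, (0 < n)%N -> rumor_process (P n) (K n) (X n))
    (growth : \forall n \near \oo, forall k : nat,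
       (1 <= k)%N -> k%:R < f * n%:R ->
       gamma n * (k%:R / n%:R) * (1 - a * (k%:R / n%:R) - b / ln n%:R)
         <= p n k
       /\ (covariance_number (K n) k <= (c * (k%:R / n%:R ^+ 2))%:E)%E) :
  (exists C : R, \forall n \near \oo,
     (\int[P n]_w spreading_time (X n) (f * n%:R) w
        <= (log_base (1 + gamma n) n%:R + C)%:E)%E)
  /\
  (exists A' alpha' : R, [/\ 0 < A', 0 < alpha' &
     \forall n \near \oo, forall r : nat,
       (P n [set w | (log_base (1 + gamma n) n%:R + r%:R)%:E
                       < spreading_time (X n) (f * n%:R) w]
          <= (A' * expR (- alpha' * r%:R))%:E)%E]).
Proof.
have g0 := andP (gamma_bnd 0%N).
have gmax0 : 0 < gmax by case: g0 => h1 h2; lra.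
(* None of these constants involves [n], hence neither do [A] and [alpha]. *)
pose theta : R := gmin * (1 - f) * ((1 - a * f) / 2).
pose eta : R := theta ^+ 2 / (2 * theta + theta ^+ 2 + c).
pose D : R := (1 + gmax) * (a + b + c + 1).
pose s : R := eta / (4 * D).
have l1 : 0 < ln (1 + gmin) by rewrite ln_gt0//; lra.
have af0 : 0 < 1 - a * f by lra.
have theta0 : 0 < theta by rewrite !mulr_gt0//; lra.
have D0 : 0 < D by rewrite mulr_gt0//; lra.
have s0 : 0 < s.
  rewrite !divr_gt0 ?exprn_gt0//; last lra.
  by rewrite ltr_wpDr// addr_gt0 ?exprn_gt0// mulr_gt0.
pose A : R := 4 * expR (2 * s * D / ln (1 + gmin) + s * ln (1 + gmax)).
pose alpha : R := s * ln (1 + gmin) / 2.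
have A0 : 0 < A by rewrite mulr_gt0// expR_gt0.
have alpha0 : 0 < alpha by rewrite divr_gt0// mulr_gt0.
(* For [ln n > M], the three summands ensure [ln n > 0], [b / ln n <= (1 - a * f) / 2] and
   [2 * D / ln n <= ln (1 + gmin) / 2]. *)
pose M : R := 1 + 2 * b / (1 - a * f) + 4 * D / ln (1 + gmin).
have main : \forall n \near \oo, [/\ (0 < n)%N, 0 <= log_base (1 + gamma n) n%:R &
    forall t : nat, log_base (1 + gamma n) n%:R - 1 <= t%:R ->
    (P n (below (X n) (f * n%:R) 0 t.+1)
       <= (A * expR (- alpha * (t%:R - log_base (1 + gamma n) n%:R)))%:E)%E].
  have := nbhs_infty_gtr (expR M).
  apply: filter_app; move: growth; apply: filterS => n growth_n Mn.
  have n0 : 0 < n%:R :> R by apply: le_lt_trans Mn; exact: expR_ge0.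
  have n0' : (0 < n)%N by rewrite -(ltr0n R).
  have Mln : M < ln n%:R by rewrite -[ltLHS]expRK ltr_ln ?posrE ?expR_gt0.
  have h1 : 0 <= 2 * b / (1 - a * f) by rewrite divr_ge0 ?(ltW af0)//; lra.
  have h2 : 0 <= 4 * D / ln (1 + gmin) by rewrite divr_ge0 ?(ltW l1)//; lra.
  have lnn0 : 0 < ln n%:R :> R by rewrite /M in Mln; lra.
  have b_small : b / ln n%:R <= (1 - a * f) / 2.
    have : 2 * b / (1 - a * f) <= ln n%:R by rewrite /M in Mln; lra.
    by rewrite !ler_pdivrMr//; lra.
  have D_small : 2 * D / ln n%:R <= ln (1 + gmin) / 2.
    have : 4 * D / ln (1 + gmin) <= ln n%:R by rewrite /M in Mln; lra.
    by rewrite !ler_pdivrMr//; lra.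
  split=> //.
    rewrite divr_ge0 ?(ltW lnn0)// ln_ge0//.
    by have /andP[] := gamma_bnd n; lra.
  exact: (growth_survival (kernelK n n0') (homK n n0') gmin_gt0 (gamma_bnd n)
    a_ge0 b_ge0 c_ge0 f_lt1 af_lt1 lnn0 b_small growth_n (procX n n0') D_small).
split.
  exists (1 + A / (1 - expR (- alpha))); apply: filterS main => n [n0 L0 surv].
  have := spreading_time_mean (procX n n0) L0 (ltW A0) alpha0 surv; exact.
exists (A * expR alpha), alpha; split=> //; first by rewrite mulr_gt0 ?expR_gt0.
apply: filterS main => n [n0 L0 surv] r.
exact: spreading_time_tail L0 (ltW A0) alpha0 surv r.
Qed.
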